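(* Let $R$ be a ring. Then either $R$ is von Neumann regular or $$\mathrm{wgl\text{-}dim}(R)=1+\max\{\mathrm{fd}_R(M): M\in\mathcal F_1\mathcal F(R)\}.$$
   Context: $R$ is an associative ring with unit and modules are unital. $\mathrm{wgl\text{-}dim}(R)$ is the weak global dimension of $R$ and $\mathrm{fd}_R$ denotes flat dimension. Here $\max$ is understood as the supremum, with value $+\infty$ allowed. $\mathcal F_1$ is the class of right $R$-modules of flat dimension at most $1$. A left $R$-module $M$ is $\mathcal F_1$-flat if $\mathrm{Tor}_1^R(H,M)=0$ for every $H\in\mathcal F_1$; the class of all $\mathcal F_1$-flat left modules is denoted $\mathcal F_1\mathcal F(R)$. *)

(* Defs.v *)
From HB Require Import structures.
From mathcomp Require Import all_boot all_order all_algebra.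
From mathcomp Require Import ring_quotient.
From mathcomp.multinomials Require Import freeg.
From mathcomp Require Import boolp classical_sets constructive_ereal.

Set Implicit Arguments.
Unset Strict Implicit.
Unset Printing Implicit Defensive.

Import Order.TTheory GRing.Theory Num.Theory.

Local Open Scope classical_set_scope.
Local Open Scope ring_scope.

(* Left R-modules are [lmodType R] and right R-modules are [lmodType R^c]; the
   right action h . r is [(r : R^c) *: h].  [R : pzRingType] allows the zero
   ring. *)

Section Tensor.
Context {R : pzRingType}.

Section Def.
Variables (H : lmodType R^c) (M : lmodType R).

Inductive tens_relator : {freeg (H * M)%type} -> Prop :=
| TensAddl h h' m :
    tens_relator (<< (h + h', m) >> - << (h, m) >> - << (h', m) >>)
| TensAddr h m m' :
    tens_relator (<< (h, m + m') >> - << (h, m) >> - << (h, m') >>)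
| TensBalance h (r : R) m :
    tens_relator (<< ((r : R^c) *: h, m) >> - << (h, r *: m) >>).

Definition tens_ker (x : {freeg (H * M)%type}) : bool :=
  `[< forall I : zmodClosed {freeg (H * M)%type},
        (forall y, tens_relator y -> y \in I) -> x \in I >].

Fact tens_ker_closed : zmod_closed tens_ker.
Proof.
split=> [|x y /asboolP xI /asboolP yI]; apply/asboolP => I sI; first exact: rpred0.
by rewrite rpredB ?xI ?yI.
Qed.
HB.instance Definition _ :=
  GRing.isZmodClosed.Build {freeg (H * M)%type} tens_ker tens_ker_closed.

Definition tens_sub : zmodClosed {freeg (H * M)%type} :=
  GRing.ZmodClosed.clone {freeg (H * M)%type} tens_ker _.

Definition tens : Type := Quotient.quot tens_sub.
HB.instance Definition _ := GRing.Zmodule.on tens.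

Definition tens_pure (h : H) (m : M) : tens :=
  \pi_(Quotient.quot tens_sub)%qT << (h, m) >>.

(* Only meaningful for biadditive balanced b, see tens_lift_pure. *)
Definition tens_lift (A : zmodType) (b : H -> M -> A) (x : tens) : A :=
  fglift (fun u => b u.1 u.2 : zmodule A) (repr (x : Quotient.quot tens_sub)).

Section Lift.
Variables (A : zmodType) (b : H -> M -> A).
Hypothesis bDl : forall h h' m, b (h + h') m = b h m + b h' m.
Hypothesis bDr : forall h m m', b h (m + m') = b h m + b h m'.
Hypothesis bZ : forall h (r : R) m, b ((r : R^c) *: h) m = b h (r *: m).

Let lft (x : {freeg (H * M)%type}) : zmodule A := fglift (fun u => b u.1 u.2 : zmodule A) x.

Let lftB x y : lft (x - y) = lft x - lft y. Proof. exact: lift_is_additive. Qed.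

Let lftU u : lft << u >> = b u.1 u.2.
Proof. by rewrite /lft liftU scale1r. Qed.

Let lft_ker (x : {freeg (H * M)%type}) : bool := lft x == 0.
Let lft_ker_closed : zmod_closed lft_ker.
Proof.
split=> [|x y /eqP x0 /eqP y0]; rewrite unfold_in /lft_ker.
  by rewrite -[0](subrr 0) lftB subrr.
by rewrite lftB x0 y0 subrr.
Qed.
HB.instance Definition _ :=
  GRing.isZmodClosed.Build {freeg (H * M)%type} lft_ker lft_ker_closed.

Let lft_pi x : tens_lift b (\pi_(Quotient.quot tens_sub)%qT x) = lft x.
Proof.
apply/eqP; rewrite -subr_eq0 -[X in X - _]/(lft _) -lftB.
have : tens_ker (repr (\pi_(Quotient.quot tens_sub)%qT x) - x).
  by rewrite -[tens_ker _]/(_ \in tens_sub) Quotient.idealrBE reprK.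
move=> /asboolP /(_ (GRing.ZmodClosed.clone {freeg (H * M)%type} lft_ker _)); apply => y [h h' m|h m m'|h r m];
  rewrite unfold_in /lft_ker !lftB !lftU /= ?bDl ?bDr ?bZ ?subrr //.
- by rewrite addrAC addrK subrr.
- by rewrite addrAC addrK subrr.
Qed.

Lemma tens_lift_pure h m : tens_lift b (tens_pure h m) = b h m.
Proof. by rewrite /tens_pure lft_pi lftU. Qed.

Lemma tens_lift_zmod_morphism : zmod_morphism (tens_lift b).
Proof.
move=> x y; rewrite -[x](@reprK _ (Quotient.quot tens_sub)).
rewrite -[y](@reprK _ (Quotient.quot tens_sub)).
by rewrite -[X in tens_lift _ X](raddfB (\pi_(Quotient.quot tens_sub)%qT)) !lft_pi lftB.
Qed.

End Lift.

Lemma tens_pureDl h h' m : tens_pure (h + h') m = tens_pure h m + tens_pure h' m.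
Proof.
apply/eqP; rewrite -subr_eq0 opprD addrA -!(raddfB (\pi_(Quotient.quot tens_sub)%qT)).
rewrite -(raddf0 (\pi_(Quotient.quot tens_sub)%qT)) -Quotient.idealrBE subr0.
by apply/asboolP => I; apply; exact: TensAddl.
Qed.

Lemma tens_pureDr h m m' : tens_pure h (m + m') = tens_pure h m + tens_pure h m'.
Proof.
apply/eqP; rewrite -subr_eq0 opprD addrA -!(raddfB (\pi_(Quotient.quot tens_sub)%qT)).
rewrite -(raddf0 (\pi_(Quotient.quot tens_sub)%qT)) -Quotient.idealrBE subr0.
by apply/asboolP => I; apply; exact: TensAddr.
Qed.

Lemma tens_pureZ h (r : R) m :
  tens_pure ((r : R^c) *: h) m = tens_pure h (r *: m).
Proof.
apply/eqP; rewrite -subr_eq0 -!(raddfB (\pi_(Quotient.quot tens_sub)%qT)).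
rewrite -(raddf0 (\pi_(Quotient.quot tens_sub)%qT)) -Quotient.idealrBE subr0.
by apply/asboolP => I; apply; exact: TensBalance.
Qed.

End Def.

Definition tens_map (H H' : lmodType R^c) (M M' : lmodType R)
    (f : {linear H -> H'}) (g : {linear M -> M'}) : tens H M -> tens H' M' :=
  tens_lift (fun h m => tens_pure (f h) (g m)).

Section MapTheory.
Variables (H H' : lmodType R^c) (M M' : lmodType R).
Variables (f : {linear H -> H'}) (g : {linear M -> M'}).

Let bDl h h' m : tens_pure (f (h + h')) (g m) =
  tens_pure (f h) (g m) + tens_pure (f h') (g m).
Proof. by rewrite raddfD tens_pureDl. Qed.
Let bDr h m m' : tens_pure (f h) (g (m + m')) =
  tens_pure (f h) (g m) + tens_pure (f h) (g m').
Proof. by rewrite raddfD tens_pureDr. Qed.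
Let bZ h (r : R) m : tens_pure (f ((r : R^c) *: h)) (g m) =
  tens_pure (f h) (g (r *: m)).
Proof. by rewrite !linearZ_LR /= tens_pureZ. Qed.

Lemma tens_map_pure h m : tens_map f g (tens_pure h m) = tens_pure (f h) (g m).
Proof. exact: tens_lift_pure. Qed.

Lemma tens_map_zmod_morphism : zmod_morphism (tens_map f g).
Proof. exact: tens_lift_zmod_morphism. Qed.
HB.instance Definition _ :=
  GRing.isZmodMorphism.Build (tens H M) (tens H' M') (tens_map f g)
    tens_map_zmod_morphism.

End MapTheory.
End Tensor.

Record resolution (S : pzRingType) (M : lmodType S) := Resolution {
  rterm : nat -> lmodType S;
  rdiff : forall i, {linear rterm i.+1 -> rterm i};
  raug : {linear rterm 0 -> M};
  raug_surj : forall m, exists x, raug x = m;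
  raug_exact : forall x, raug x = 0 <-> exists y, x = rdiff 0 y;
  rdiff_exact : forall i x, rdiff i x = 0 <-> exists y, x = rdiff i.+1 y
}.

Definition projective (S : pzRingType) (P : lmodType S) : Prop :=
  forall (A B : lmodType S) (g : {linear A -> B}) (f : {linear P -> B}),
    (forall b, exists a, g a = b) ->
    exists h : {linear P -> A}, forall x, g (h x) = f x.

(* M has a resolution 0 -> C_n -> ... -> C_0 -> M -> 0 with all C_i in C; the
   terms beyond n are the zero module, which lies in every class C used here. *)
Definition res_dim_le (S : pzRingType) (C : lmodType S -> Prop) (M : lmodType S)
    (n : nat) : Prop :=
  exists F : resolution M,
    (forall i, C (rterm F i)) /\
    (forall i, (n < i)%N -> forall x : rterm F i, x = 0).

(* Values in N u {+oo}, as extended integers; +oo when no such n exists. *)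
Definition res_dim (S : pzRingType) (C : lmodType S -> Prop) (M : lmodType S) :
    \bar int :=
  infimum +oo%E [set n%:Z%:E | n in [set n | res_dim_le C M n]].

Section FlatDimension.
Variable R : pzRingType.

Definition flatl (M : lmodType R) : Prop :=
  forall (N N' : lmodType R^c) (f : {linear N -> N'}),
    injective f -> injective (tens_map f (idfun : {linear M -> M})).

Definition flatr (H : lmodType R^c) : Prop :=
  forall (N N' : lmodType R) (f : {linear N -> N'}),
    injective f -> injective (tens_map (idfun : {linear H -> H}) f).

Definition fdl : lmodType R -> \bar int := res_dim flatl.

Definition fdr : lmodType R^c -> \bar int := res_dim flatr.

Definition wgldim : \bar int :=
  supremum -oo%E [set d | exists M : lmodType R, d = fdl M].

(* Tor_{n+1}^R(H, M) = 0: the homology of P (x) M at P_{n+1} (x) M vanishes for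
   any projective resolution P of H (up to isomorphism it does not depend on
   the choice of P). *)
Definition TorS_eq0 (n : nat) (H : lmodType R^c) (M : lmodType R) : Prop :=
  forall P : resolution H, (forall i, projective (rterm P i)) ->
  forall x : tens (rterm P n.+1) M,
    tens_map (rdiff P n) (idfun : {linear M -> M}) x = 0 ->
    exists y : tens (rterm P n.+2) M,
      x = tens_map (rdiff P n.+1) (idfun : {linear M -> M}) y.

Definition F1 (H : lmodType R^c) : Prop := (fdr H <= 1%:E)%E.

Definition F1F (M : lmodType R) : Prop :=
  forall H : lmodType R^c, F1 H -> TorS_eq0 0 H M.

Definition von_neumann_regular : Prop :=
  forall a : R, exists x : R, a * x * a = a.

End FlatDimension.

(* Main.v *)
(* For short exact sequences
   0 -> A -> B -> H -> 0 and 0 -> L -> Q -> M -> 0 with B and Q flat, a chase in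
   the 3 x 3 grid of tensor products gives Tor_1(A, M) = 0 iff Tor_1(H, L) = 0
   (both say Tor_2(H, M) = 0).  Iterating, fd M <= n iff Tor_1(Syz^n H, M) = 0
   for all right modules H.
   Upper bound: if fd H <= 1 then A can be chosen flat, so the kernel L of any
   free cover of M is F_1-flat, and fd M <= 1 + fd L.
   Lower bound: if every left module has flat dimension at most n + 1, then
   Syz^(n+1) H is flat, so Syz^n H lies in F_1 for every H, hence
   Tor_1(Syz^n H, M) = 0 for every F_1-flat M, i.e. fd M <= n.  The remaining
   case of weak dimension 0 forces R to be von Neumann regular. *)

From HB Require Import structures.
Require Import Defs.
From mathcomp Require Import all_boot all_order all_algebra.
From mathcomp Require Import boolp classical_sets functions constructive_ereal.
From mathcomp Require Import ring_quotient.
From mathcomp.multinomials Require Import freeg.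

Set Implicit Arguments.
Unset Strict Implicit.
Unset Printing Implicit Defensive.

Import Order.TTheory GRing.Theory Num.Theory.

Local Open Scope classical_set_scope.
Local Open Scope ring_scope.

(** * Tensor products *)

Section TensorInduction.
Variables (R : pzRingType) (H : lmodType R^c) (M : lmodType R).

(** Closure under differences already gives 0, opposites, sums and integer multiples. A
    representative in the free abelian group is an integer combination of pairs, so pure tensors
    suffice. *)
Lemma tens_ind (P : tens H M -> Prop) :
  (forall x y, P x -> P y -> P (x - y)) -> (forall h m, P (tens_pure h m)) ->
  forall x, P x.
Proof.
move=> PB Pp x.
have P0 : P 0 by rewrite -(subrr (tens_pure 0 0)); apply: PB.
have PN y : P y -> P (- y) by move=> Py; rewrite -sub0r; apply: PB.
have PD y z : P y -> P z -> P (y + z).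
  by move=> Py Pz; rewrite -[z]opprK; apply: PB => //; apply: PN.
have PMn y n : P y -> P (y *+ n).
  by move=> Py; elim: n => [|n IHn]; rewrite ?mulr0n // mulrS; apply: PD.
rewrite -[x](@reprK _ (Quotient.quot (tens_sub H M))).
rewrite -[repr _]freeg_sumE raddf_sum; apply: (big_ind P) => // u _.
have -> k : << k *g u >> = << u >> *~ k :> {freeg (H * M)%type}.
  by rewrite freegU_mulz intz.
rewrite raddfMz; case: (coeff _ _) => n /=.
  by rewrite -pmulrn; apply: PMn; case: u => h m; apply: Pp.
by rewrite NegzE mulrNz; apply/PN; rewrite -pmulrn; apply: PMn; case: u => h m; apply: Pp.
Qed.

Lemma tens_ext (A : zmodType) (f g : {additive tens H M -> A}) :
  (forall h m, f (tens_pure h m) = g (tens_pure h m)) -> f =1 g.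
Proof.
move=> fg; apply: tens_ind => [x y fgx fgy|]; rewrite ?raddfB //.
by rewrite fgx fgy.
Qed.

Lemma tens_pureBl (h h' : H) (m : M) : tens_pure (h - h') m = tens_pure h m - tens_pure h' m.
Proof. by apply: (addIr (tens_pure h' m)); rewrite -tens_pureDl !subrK. Qed.

Lemma tens_pureBr (h : H) (m m' : M) : tens_pure h (m - m') = tens_pure h m - tens_pure h m'.
Proof. by apply: (addIr (tens_pure h m')); rewrite -tens_pureDr !subrK. Qed.

Lemma tens_pure0l (m : M) : tens_pure (0 : H) m = 0.
Proof. by rewrite -(subrr 0) tens_pureBl subrr. Qed.

Lemma tens_pure0r (h : H) : tens_pure h (0 : M) = 0.
Proof. by rewrite -(subrr 0) tens_pureBr subrr. Qed.

Lemma tens_pure_suml (I : Type) (s : seq I) (F : I -> H) (m : M) :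
  tens_pure (\sum_(i <- s) F i) m = \sum_(i <- s) tens_pure (F i) m.
Proof.
by rewrite (big_morph (fun h => tens_pure h m) (fun h h' => tens_pureDl h h' m)
  (tens_pure0l m)).
Qed.

Lemma tens_pure_sumr (I : Type) (s : seq I) (h : H) (F : I -> M) :
  tens_pure h (\sum_(i <- s) F i) = \sum_(i <- s) tens_pure h (F i).
Proof. by rewrite (big_morph (tens_pure h) (tens_pureDr h) (tens_pure0r h)). Qed.

End TensorInduction.

(** * Kernels, cokernels and free modules *)

Section KernelModule.
Variables (S : pzRingType) (A B : lmodType S) (f : {linear A -> B}).

Definition in_ker (x : A) : bool := f x == 0.

Fact in_ker_closed : submod_closed in_ker.
Proof.
split=> [|a x y /eqP fx /eqP fy]; rewrite unfold_in /in_ker ?raddf0 //.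
by rewrite linearP fx fy scaler0 addr0.
Qed.
HB.instance Definition _ := GRing.isSubmodClosed.Build S A in_ker in_ker_closed.

Record kermod : Type := Kermod { kermod_val :> A; kermodP : in_ker kermod_val }.
HB.instance Definition _ := [isSub for kermod_val].
HB.instance Definition _ := [Choice of kermod by <:].
HB.instance Definition _ := [SubChoice_isSubLmodule of kermod by <:].

Definition kermod_incl : {linear kermod -> A} := (val : kermod -> A).

Lemma kermod_incl_inj : injective kermod_incl. Proof. exact: val_inj. Qed.

Lemma kermod_incl0 x : f (kermod_incl x) = 0.
Proof. by case: x => x /= /eqP. Qed.

Lemma kermod_lift x : f x = 0 -> exists y, kermod_incl y = x.
Proof. by move/eqP=> fx; exists (Kermod fx). Qed.

Variables (C : lmodType S) (g : {linear C -> A}).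
Hypothesis fg0 : forall x, f (g x) = 0.

Let fg0P x : in_ker (g x). Proof. by apply/eqP. Qed.

Definition kermod_corestr (x : C) : kermod := Kermod (fg0P x).

Fact kermod_corestr_linear : linear kermod_corestr.
Proof. by move=> a x y; apply: val_inj; rewrite /= linearP. Qed.
HB.instance Definition _ :=
  GRing.isLinear.Build S C kermod *:%R kermod_corestr kermod_corestr_linear.

End KernelModule.

Section CokernelModule.
Variables (S : pzRingType) (A B : lmodType S) (f : {linear A -> B}).

Definition in_range (y : B) : bool := `[< exists x, y = f x >].

Fact in_range_closed : submod_closed in_range.
Proof.
split=> [|a x y /asboolP[u ->] /asboolP[v ->]]; apply/asboolP.
  by exists 0; rewrite raddf0.
by exists (a *: u + v); rewrite linearP.
Qed.
HB.instance Definition _ := GRing.isSubmodClosed.Build S B in_range in_range_closed.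

Definition cokermod : Type :=
  Quotient.quot (GRing.ZmodClosed.clone B in_range _).
HB.instance Definition _ := GRing.Zmodule.on cokermod.

Definition cokermod_pi (y : B) : cokermod :=
  \pi_(Quotient.quot (GRing.ZmodClosed.clone B in_range _))%qT y.

Lemma cokermod_piE x y : cokermod_pi x = cokermod_pi y <-> exists z, x - y = f z.
Proof.
split=> [/eqP|[z xy]]; last by apply/eqP; rewrite -Quotient.idealrBE; apply/asboolP; exists z.
by rewrite -Quotient.idealrBE => /asboolP.
Qed.

Fact cokermod_pi_zmod : zmod_morphism cokermod_pi.
Proof. by move=> x y; rewrite /cokermod_pi raddfB. Qed.
HB.instance Definition _ :=
  GRing.isZmodMorphism.Build B cokermod cokermod_pi cokermod_pi_zmod.

Definition cokermod_repr (x : cokermod) : B :=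
  repr (x : Quotient.quot (GRing.ZmodClosed.clone B in_range _)).

Lemma cokermod_reprK x : cokermod_pi (cokermod_repr x) = x.
Proof. exact: (@reprK _ (Quotient.quot _)). Qed.

(** The action goes through a chosen representative. It is independent of the choice because the
    range of [f] is a submodule; the module axioms are then inherited from [B]. *)
Definition cokermod_scale (a : S) (x : cokermod) := cokermod_pi (a *: cokermod_repr x).

Lemma cokermod_scaleE a x : cokermod_scale a (cokermod_pi x) = cokermod_pi (a *: x).
Proof.
apply/cokermod_piE; have /cokermod_piE[z xz] := cokermod_reprK (cokermod_pi x).
by exists (a *: z); rewrite -scalerBr xz linearZ.
Qed.

Fact cokermod_scaleA a b x :
  cokermod_scale a (cokermod_scale b x) = cokermod_scale (a * b) x.
Proof. by rewrite -[x]cokermod_reprK !cokermod_scaleE scalerA. Qed.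
Fact cokermod_scale1 : left_id 1 cokermod_scale.
Proof. by move=> x; rewrite -[x]cokermod_reprK cokermod_scaleE scale1r. Qed.
Fact cokermod_scaleDr : right_distributive cokermod_scale +%R.
Proof.
move=> a x y; rewrite -[x]cokermod_reprK -[y]cokermod_reprK -raddfD.
by rewrite !cokermod_scaleE scalerDr raddfD.
Qed.
Fact cokermod_scaleDl x : {morph cokermod_scale^~ x : a b / a + b}.
Proof.
by move=> a b; rewrite -[x]cokermod_reprK !cokermod_scaleE scalerDl raddfD.
Qed.
HB.instance Definition _ := GRing.Zmodule_isLmodule.Build S cokermod
  cokermod_scaleA cokermod_scale1 cokermod_scaleDr cokermod_scaleDl.

Fact cokermod_pi_linear : scalable cokermod_pi.
Proof. by move=> a x; rewrite -cokermod_scaleE. Qed.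
HB.instance Definition _ :=
  GRing.isScalable.Build S B cokermod *:%R cokermod_pi cokermod_pi_linear.

Lemma cokermod_pi0 y : cokermod_pi y = 0 <-> exists x, y = f x.
Proof. by rewrite -(raddf0 cokermod_pi) cokermod_piE subr0. Qed.

End CokernelModule.

(** * Free modules as finitely supported functions *)

Section FreeModule.
Variables (S : pzRingType) (T : choiceType).

Definition finsupp (f : T -> S^o) : bool :=
  `[< exists s : seq T, forall t, t \notin s -> f t = 0 :> S >].

Fact finsupp_closed : submod_closed finsupp.
Proof.
split=> [|a f g /asboolP[s fs] /asboolP[s' gs']]; apply/asboolP; first by exists [::].
exists (s ++ s') => t; rewrite mem_cat negb_or => /andP[ts ts'].
transitivity ((a : S) * f t + g t); first by [].
by rewrite fs // gs' // mulr0 addr0.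
Qed.
HB.instance Definition _ :=
  GRing.isSubmodClosed.Build S (T -> S^o) finsupp finsupp_closed.

Record freemod : Type := Freemod { freemod_fun : T -> S^o; freemodP : finsupp freemod_fun }.
HB.instance Definition _ := [isSub for freemod_fun].
HB.instance Definition _ := [Choice of freemod by <:].
HB.instance Definition _ := [SubChoice_isSubLmodule of freemod by <:].

Definition freemod_coef (x : freemod) (t : T) : S := freemod_fun x t.
Local Coercion freemod_coef : freemod >-> Funclass.

Lemma freemod0 t : (0 : freemod) t = 0. Proof. by []. Qed.
Lemma freemodD (x y : freemod) t : (x + y) t = x t + y t. Proof. by []. Qed.
Lemma freemodZ a (x : freemod) t : (a *: x) t = a * x t. Proof. by []. Qed.

Lemma freemod_supp (x : freemod) :
  { s : seq T | uniq s & forall t, t \notin s -> x t = 0 }.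
Proof.
have /asboolP/cid[s xs] := freemodP x.
by exists (undup s); rewrite ?undup_uniq // => t; rewrite mem_undup; apply: xs.
Qed.

Fact freemod_delta_subproof (t : T) : finsupp (fun u => (u == t)%:R).
Proof. by apply/asboolP; exists [:: t] => u; rewrite inE => /negPf->. Qed.
Definition freemod_delta t := Freemod (freemod_delta_subproof t).

Lemma freemod_deltaE t u : freemod_delta t u = (u == t)%:R. Proof. by []. Qed.

Lemma freemod_eqP (x y : freemod) : (forall t, x t = y t) -> x = y.
Proof. by move=> xy; apply/val_inj/funext. Qed.

Section Extension.
Variables (A : lmodType S) (g : T -> A).

Definition freemod_ext (x : freemod) : A := \sum_(t <- s2val (freemod_supp x)) x t *: g t.

(** Any two lists covering the support agree, up to permutation, once the zero coefficients are
    filtered out. Several elements can thus be summed over one common list. *)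
Lemma freemod_extE (x : freemod) s : uniq s -> (forall t, t \notin s -> x t = 0) ->
  freemod_ext x = \sum_(t <- s) x t *: g t.
Proof.
rewrite /freemod_ext; case: (freemod_supp x) => s' /= us' xs' us xs.
have E u : \sum_(t <- u) x t *: g t = \sum_(t <- [seq t <- u | x t != 0]) x t *: g t.
  rewrite big_filter [LHS](bigID (fun t => x t == 0)) /= big1 ?add0r //.
  by move=> t /eqP->; rewrite scale0r.
rewrite E [RHS]E; apply: perm_big; apply: uniq_perm; rewrite ?filter_uniq // => t.
rewrite !mem_filter; case: eqVneq => //= xt.
by rewrite (contra_neqT (xs' t) xt) (contra_neqT (xs t) xt).
Qed.

Fact freemod_ext_linear : linear freemod_ext.
Proof.
move=> a x y; have [s us xs] := freemod_supp x; have [s' us' ys] := freemod_supp y.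
pose u := undup (s ++ s').
have xu t : t \notin u -> x t = 0.
  by rewrite mem_undup mem_cat negb_or => /andP[/xs].
have yu t : t \notin u -> y t = 0.
  by rewrite mem_undup mem_cat negb_or => /andP[_ /ys].
rewrite !(@freemod_extE _ u) ?undup_uniq //; last first.
  by move=> t tu; rewrite freemodD freemodZ xu // yu // mulr0 addr0.
rewrite scaler_sumr -big_split; apply: eq_bigr => t _.
by rewrite freemodD freemodZ scalerDl scalerA.
Qed.
HB.instance Definition _ :=
  GRing.isLinear.Build S freemod A *:%R freemod_ext freemod_ext_linear.

Lemma freemod_ext_delta t : freemod_ext (freemod_delta t) = g t.
Proof.
rewrite (@freemod_extE _ [:: t]) ?big_seq1 //= ?eqxx ?scale1r // => u.
by rewrite inE => /negPf ->.
Qed.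

Lemma freemod_ext_unique (h : {linear freemod -> A}) :
  (forall t, h (freemod_delta t) = g t) -> h =1 freemod_ext.
Proof.
move=> hg x; have [s us xs] := freemod_supp x.
rewrite (freemod_extE us xs).
suff {1}->: x = \sum_(t <- s) x t *: freemod_delta t.
  by rewrite linear_sum; apply: eq_bigr => t _; rewrite linearZ /= hg.
apply: freemod_eqP => t; rewrite (big_morph (freemod_coef^~ t) (fun y z => freemodD y z t)
  (freemod0 t)).
have [ts|ts] := boolP (t \in s); last first.
  rewrite xs // big_seq big1 // => u us'.
  rewrite freemodZ freemod_deltaE; case: eqP => [tu|_]; last by rewrite mulr0.
  by rewrite tu us' in ts.
rewrite (bigD1_seq t) // big1 => [|u ut].
  by rewrite [RHS]addr0 freemodZ freemod_deltaE eqxx mulr1.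
by rewrite freemodZ freemod_deltaE eq_sym (negPf ut) mulr0.
Qed.

End Extension.

Lemma freemod_projective : projective freemod.
Proof.
move=> A B g f g_surj.
pose a t := sval (cid (g_surj (f (freemod_delta t)))).
exists (freemod_ext a) => x.
rewrite -[LHS]/((g \o freemod_ext a) x).
rewrite (@freemod_ext_unique _ (f \o freemod_delta) f) //.
apply: freemod_ext_unique => t /=.
by rewrite freemod_ext_delta /a; case: cid.
Qed.

End FreeModule.

(** * Right exactness and flatness of projectives *)

Local Notation rtens f M := (tens_map f (idfun : {linear M -> M})).
Local Notation ltens H g := (tens_map (idfun : {linear H -> H}) g).

Section Exactness.
Variable R : pzRingType.

Lemma tens_mapB (H1 H2 : lmodType R^c) (M1 M2 : lmodType R)
    (f : {linear H1 -> H2}) (g : {linear M1 -> M2}) x y :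
  tens_map f g (x - y) = tens_map f g x - tens_map f g y.
Proof. exact: raddfB. Qed.

Lemma tens_map0 (H1 H2 : lmodType R^c) (M1 M2 : lmodType R)
    (f : {linear H1 -> H2}) (g : {linear M1 -> M2}) : tens_map f g 0 = 0.
Proof. exact: raddf0. Qed.

Lemma tens_map_comp (H1 H2 H3 : lmodType R^c) (M1 M2 M3 : lmodType R)
    (f : {linear H1 -> H2}) (f' : {linear H2 -> H3})
    (g : {linear M1 -> M2}) (g' : {linear M2 -> M3}) x :
  tens_map f' g' (tens_map f g x) = tens_map (f' \o f) (g' \o g) x.
Proof.
elim/tens_ind: x => [x y xE yE|h m]; last by rewrite !tens_map_pure.
by rewrite !tens_mapB xE yE.
Qed.

Lemma eq_tens_map (H1 H2 : lmodType R^c) (M1 M2 : lmodType R)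
    (f f' : {linear H1 -> H2}) (g g' : {linear M1 -> M2}) :
  f =1 f' -> g =1 g' -> tens_map f g =1 tens_map f' g'.
Proof. by move=> ff gg; apply: tens_ext => h m /=; rewrite !tens_map_pure ff gg. Qed.

Lemma tens_map_surj (H1 H2 : lmodType R^c) (M1 M2 : lmodType R)
    (f : {linear H1 -> H2}) (g : {linear M1 -> M2}) :
  (forall y, exists x, f x = y) -> (forall y, exists x, g x = y) ->
  forall y, exists x, tens_map f g x = y.
Proof.
move=> fs gs; apply: tens_ind => [_ _ [x <-] [y <-]|h m].
  by exists (x - y); rewrite tens_mapB.
by have [h' <-] := fs h; have [m' <-] := gs m; exists (tens_pure h' m'); rewrite tens_map_pure.
Qed.

Section TensorKernel.
Variables (H1 H2 : lmodType R^c) (M1 M2 : lmodType R).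
Variables (f : {linear H1 -> H2}) (g : {linear M1 -> M2}).
Hypothesis f_surj : forall y, exists x, f x = y.
Hypothesis g_surj : forall y, exists x, g x = y.

(** Common source of right exactness in both variables: the kernel of a tensor product of
    surjections is generated by the pure tensors with a factor in ker f or ker g. The proof builds a
    left inverse, modulo [J], of the map [tens_map f g]. *)
Lemma tens_map_ker (J : zmodClosed (tens H1 M1)) :
  (forall h m, f h = 0 -> tens_pure h m \in J) ->
  (forall h m, g m = 0 -> tens_pure h m \in J) ->
  forall x, tens_map f g x = 0 -> x \in J.
Proof.
move=> Jf Jg.
pose pr := \pi_(Quotient.quot J)%qT : tens H1 M1 -> Quotient.quot J.
pose s h := sval (cid (f_surj h)); have sK h : f (s h) = h by rewrite /s; case: cid.
pose t m := sval (cid (g_surj m)); have tK m : g (t m) = m by rewrite /t; case: cid.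
(* Modulo [J] the choice of preimages is irrelevant, since h (x) m - h' (x) m' = (h - h') (x) m + h'
   (x) (m - m'). This makes [b] below biadditive and balanced although [s] and [t] are arbitrary
   sections. *)
have prE h h' m m' : f h = f h' -> g m = g m' ->
    pr (tens_pure h m) = pr (tens_pure h' m').
  move=> ff gg; apply/eqP; rewrite -Quotient.idealrBE.
  rewrite -[tens_pure h m](subrK (tens_pure h' m)) -addrA -tens_pureBl -tens_pureBr.
  by apply: rpredD; [apply: Jf|apply: Jg]; rewrite linearB /= ?ff ?gg subrr.
pose b h m := pr (tens_pure (s h) (t m)).
have bDl h h' m : b (h + h') m = b h m + b h' m.
  rewrite /b -raddfD -tens_pureDl; apply: prE; rewrite // linearD /= !sK //.
have bDr h m m' : b h (m + m') = b h m + b h m'.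
  rewrite /b -raddfD -tens_pureDr; apply: prE; rewrite // linearD /= !tK //.
have bZ h (r : R) m : b ((r : R^c) *: h) m = b h (r *: m).
  rewrite /b; transitivity (pr (tens_pure ((r : R^c) *: s h) (t m))).
    by apply: prE; rewrite // linearZ /= !sK.
  by rewrite tens_pureZ; apply: prE; rewrite // linearZ /= !tK.
have lB := tens_lift_zmod_morphism bDl bDr bZ.
have liftE : forall x, tens_lift b (tens_map f g x) = pr x.
  apply: tens_ind => [x y xE yE|h m]; first by rewrite tens_mapB lB xE yE -raddfB.
  by rewrite tens_map_pure tens_lift_pure //; apply: prE; rewrite ?sK ?tK.
move=> x x0; have := liftE x; rewrite x0 -(subrr 0) lB subrr => /esym/eqP.
by rewrite -(raddf0 pr) -Quotient.idealrBE subr0.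
Qed.

End TensorKernel.

Section AdditiveRange.
Variables (U V : zmodType) (f : {additive U -> V}).

Definition in_zrange (y : V) : bool := `[< exists x, y = f x >].

Fact in_zrange_closed : zmod_closed in_zrange.
Proof.
split=> [|x y /asboolP[u ->] /asboolP[v ->]]; apply/asboolP.
  by exists 0; rewrite raddf0.
by exists (u - v); rewrite raddfB.
Qed.
HB.instance Definition _ := GRing.isZmodClosed.Build V in_zrange in_zrange_closed.

Definition zrange : zmodClosed V := GRing.ZmodClosed.clone V in_zrange _.

Lemma zrangeP y : reflect (exists x, y = f x) (y \in zrange).
Proof. exact: asboolP. Qed.

End AdditiveRange.

Lemma rtens_exact (A B C : lmodType R^c) (M : lmodType R)
    (f : {linear A -> B}) (g : {linear B -> C}) :
  (forall c, exists b, g b = c) -> (forall b, g b = 0 -> exists a, b = f a) ->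
  forall x, rtens g M x = 0 -> exists y, x = rtens f M y.
Proof.
move=> g_surj fg x x0; apply/zrangeP; apply: tens_map_ker x0 => //.
- by move=> m; exists m.
- move=> h m /fg[a ->]; apply/zrangeP.
  by exists (tens_pure a m); rewrite /= tens_map_pure.
- by move=> h m /= ->; rewrite tens_pure0r rpred0.
Qed.

Lemma ltens_exact (H : lmodType R^c) (A B C : lmodType R)
    (f : {linear A -> B}) (g : {linear B -> C}) :
  (forall c, exists b, g b = c) -> (forall b, g b = 0 -> exists a, b = f a) ->
  forall x, ltens H g x = 0 -> exists y, x = ltens H f y.
Proof.
move=> g_surj fg x x0; apply/zrangeP; apply: tens_map_ker x0 => //.
- by move=> h; exists h.
- by move=> h m /= ->; rewrite tens_pure0l rpred0.
- move=> h m /fg[a ->]; apply/zrangeP.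
  by exists (tens_pure h a); rewrite /= tens_map_pure.
Qed.

End Exactness.

(** * Dual bases and flatness of projective modules *)

Section ProjectiveFlat.

(** Dual basis lemma with all elements of [P] as generators: [h] splits the surjection from the free
    module on [P], and its coordinates are the dual functionals. *)
Lemma projective_dual_basis (S : pzRingType) (P : lmodType S) : projective P ->
  exists2 h : {linear P -> freemod S P},
    forall x, exists2 s : seq P, uniq s & forall t, t \notin s -> freemod_coef (h x) t = 0
    & forall x s, uniq s -> (forall t, t \notin s -> freemod_coef (h x) t = 0) ->
      x = \sum_(t <- s) freemod_coef (h x) t *: t.
Proof.
move=> Pproj.
have [|h hK] := Pproj _ _ (freemod_ext id : {linear freemod S P -> P}) (idfun : {linear P -> P}).
  by move=> b; exists (freemod_delta S b); rewrite /= freemod_ext_delta.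
exists h => [x|x s us xs]; first by have [s us xs] := freemod_supp (h x); exists s.
by rewrite -[LHS]hK /= (freemod_extE _ us xs).
Qed.

Variable R : pzRingType.

(** Each dual functional t induces a coordinate map [c N t] from N (x) P to N, natural in N, and an
    element is recovered from its coordinates. If f (x) P kills x, then f kills every coordinate of
    x, so these vanish. *)
Lemma projective_flatl (P : lmodType R) : projective P -> flatl P.
Proof.
move=> /projective_dual_basis[h hfin hE] N N' f f_inj.
pose b (N : lmodType R^c) t (n : N) (p : P) : N := (freemod_coef (h p) t : R^c) *: n.
pose c N t := tens_lift (b N t).
have bDl N0 t : forall n n' p, b N0 t (n + n') p = b N0 t n p + b N0 t n' p.
  by move=> n n' p; rewrite /b scalerDr.
have bDr N0 t : forall n p p', b N0 t n (p + p') = b N0 t n p + b N0 t n p'.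
  by move=> n p p'; rewrite /b raddfD scalerDl.
have bZ N0 t : forall n (r : R) p, b N0 t ((r : R^c) *: n) p = b N0 t n (r *: p).
  by move=> n r p; rewrite /b linearZ /= scalerA.
have cB N0 t : zmod_morphism (c N0 t) := tens_lift_zmod_morphism (bDl N0 t) (bDr N0 t) (bZ N0 t).
have cE N0 t n p : c N0 t (tens_pure n p) = b N0 t n p
  by exact: (tens_lift_pure (bDl N0 t) (bDr N0 t) (bZ N0 t)).
have c_nat t x : c N' t (rtens f P x) = f (c N t x).
  elim/tens_ind: x => [x y xE yE|n p]; first by rewrite tens_mapB !cB xE yE linearB.
  by rewrite tens_map_pure !cE /b linearZ.
(* Allowing every larger list [u] lets the expansions of two tensors be subtracted over a common
   list. *)
have c_dec x : exists s : seq P, forall u, uniq u -> {subset s <= u} ->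
    x = \sum_(t <- u) tens_pure (c N t x) t.
  elim/tens_ind: x => [x y [s xE] [s' yE]|n p].
    exists (s ++ s') => u uu su.
    have {1}-> : x = \sum_(t <- u) tens_pure (c N t x) t.
      by apply: xE => // t ts; apply: su; rewrite mem_cat ts.
    have {1}-> : y = \sum_(t <- u) tens_pure (c N t y) t.
      by apply: yE => // t ts; apply: su; rewrite mem_cat ts orbT.
    by rewrite -sumrB; apply: eq_bigr => t _; rewrite cB tens_pureBl.
  have [s us hs] := hfin p; exists s => u uu su.
  have {1}-> := hE p u uu; last by move=> t /(contra (su t))/hs.
  rewrite tens_pure_sumr; apply: eq_bigr => t _.
  by rewrite cE /b tens_pureZ.
apply: raddf_inj => x x0; have [s xE] := c_dec x.
rewrite (xE (undup s)) ?undup_uniq // => [|t]; last by rewrite mem_undup.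
rewrite big1 // => t _; suff -> : c N t x = 0 by rewrite tens_pure0l.
by apply: f_inj; rewrite -c_nat x0 raddf0 -(subrr 0) cB subrr.
Qed.

(** The same coordinate argument with the two sides exchanged. *)
Lemma projective_flatr (P : lmodType R^c) : projective P -> flatr P.
Proof.
move=> /projective_dual_basis[h hfin hE] N N' f f_inj.
pose b (N : lmodType R) t (p : P) (n : N) : N := (freemod_coef (h p) t : R) *: n.
pose c N t := tens_lift (b N t).
have bDl N0 t : forall p p' n, b N0 t (p + p') n = b N0 t p n + b N0 t p' n.
  by move=> p p' n; rewrite /b raddfD scalerDl.
have bDr N0 t : forall p n n', b N0 t p (n + n') = b N0 t p n + b N0 t p n'.
  by move=> p n n'; rewrite /b scalerDr.
have bZ N0 t : forall p (r : R) n, b N0 t ((r : R^c) *: p) n = b N0 t p (r *: n).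
  by move=> p r n; rewrite /b linearZ /= scalerA.
have cB N0 t : zmod_morphism (c N0 t) := tens_lift_zmod_morphism (bDl N0 t) (bDr N0 t) (bZ N0 t).
have cE N0 t p n : c N0 t (tens_pure p n) = b N0 t p n
  by exact: (tens_lift_pure (bDl N0 t) (bDr N0 t) (bZ N0 t)).
have c_nat t x : c N' t (ltens P f x) = f (c N t x).
  elim/tens_ind: x => [x y xE yE|p n]; first by rewrite tens_mapB !cB xE yE linearB.
  by rewrite tens_map_pure !cE /b linearZ.
have c_dec x : exists s : seq P, forall u, uniq u -> {subset s <= u} ->
    x = \sum_(t <- u) tens_pure t (c N t x).
  elim/tens_ind: x => [x y [s xE] [s' yE]|p n].
    exists (s ++ s') => u uu su.
    have {1}-> : x = \sum_(t <- u) tens_pure t (c N t x).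
      by apply: xE => // t ts; apply: su; rewrite mem_cat ts.
    have {1}-> : y = \sum_(t <- u) tens_pure t (c N t y).
      by apply: yE => // t ts; apply: su; rewrite mem_cat ts orbT.
    by rewrite -sumrB; apply: eq_bigr => t _; rewrite cB tens_pureBr.
  have [s us hs] := hfin p; exists s => u uu su.
  have {1}-> := hE p u uu; last by move=> t /(contra (su t))/hs.
  rewrite tens_pure_suml; apply: eq_bigr => t _.
  by rewrite cE /b -tens_pureZ.
apply: raddf_inj => x x0; have [s xE] := c_dec x.
rewrite (xE (undup s)) ?undup_uniq // => [|t]; last by rewrite mem_undup.
rewrite big1 // => t _; suff -> : c N t x = 0 by rewrite tens_pure0r.
by apply: f_inj; rewrite -c_nat x0 raddf0 -(subrr 0) cB subrr.
Qed.

End ProjectiveFlat.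

(** * Vanishing of Tor *)

Section ShortExact.
Variable S : pzRingType.

Record short_exact (A B C : lmodType S) (i : {linear A -> B}) (p : {linear B -> C}) : Prop :=
  ShortExact {
    ses_inj : injective i;
    ses_comp0 : forall a, p (i a) = 0;
    ses_exact : forall b, p b = 0 -> exists a, b = i a;
    ses_surj : forall c, exists b, p b = c }.

Lemma kermod_ses (B C : lmodType S) (p : {linear B -> C}) :
  (forall c, exists b, p b = c) -> short_exact (kermod_incl p) p.
Proof.
split=> // [|b]; first exact: kermod_incl0.
by move=> /kermod_lift[x <-]; exists x.
Qed.

Lemma cokermod_ses (A B : lmodType S) (i : {linear A -> B}) :
  injective i -> short_exact i (cokermod_pi i).
Proof.
move=> i_inj; split=> // [a|b|c]; [|by move/cokermod_pi0 |].
  by apply/cokermod_pi0; exists a.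
by exists (cokermod_repr c); rewrite /= cokermod_reprK.
Qed.

Definition free_cover (M : lmodType S) : {linear freemod S M -> M} :=
  freemod_ext (id : M -> M).

Lemma free_cover_surj (M : lmodType S) m : exists x, free_cover M x = m.
Proof. by exists (freemod_delta S m); rewrite /= freemod_ext_delta. Qed.

Definition syzygy1 (M : lmodType S) : lmodType S := kermod (free_cover M).

Lemma syzygy1_ses (M : lmodType S) :
  short_exact (kermod_incl (free_cover M)) (free_cover M).
Proof. exact/kermod_ses/free_cover_surj. Qed.

Fixpoint syzygy (n : nat) (M : lmodType S) : lmodType S :=
  if n is n'.+1 then syzygy1 (syzygy n' M) else M.

Fact free_resolution_exact0 (M : lmodType S) x : free_cover M x = 0 <->
  exists y, x = (kermod_incl (free_cover M) \o free_cover (syzygy 1 M)) y.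
Proof.
split=> [/kermod_lift[y <-]|[y ->]]; last exact: kermod_incl0.
by have [z <-] := free_cover_surj y; exists z.
Qed.

Fact free_resolution_exact (M : lmodType S) i x :
  (kermod_incl (free_cover (syzygy i M)) \o free_cover (syzygy i.+1 M)) x = 0 <->
  exists y,
    x = (kermod_incl (free_cover (syzygy i.+1 M)) \o free_cover (syzygy i.+2 M)) y.
Proof.
(* The inclusion of a syzygy is injective, so exactness in positive degree reduces to exactness at
   the start of the resolution of [syzygy i.+1 M]. *)
rewrite -(free_resolution_exact0 (M := syzygy i.+1 M)); split=> x0.
  by apply: kermod_incl_inj; rewrite raddf0.
by rewrite -(raddf0 (kermod_incl (free_cover (syzygy i M)))) -x0.
Qed.

Definition free_resolution (M : lmodType S) : resolution M :=
  @Resolution S M (fun i => freemod S (syzygy i M))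
    (fun i => kermod_incl (free_cover (syzygy i M)) \o free_cover (syzygy i.+1 M))
    (free_cover M) (@free_cover_surj M) (@free_resolution_exact0 M)
    (@free_resolution_exact M).

End ShortExact.

(* Rows of the grid are indexed by K -> P -> H (maps a, b) and columns by
   L -> Q -> M (maps u, v). *)
Lemma grid_chase (KL KQ KM PL PQ PM HL HQ : zmodType)
    (aL : {additive KL -> PL}) (bL : {additive PL -> HL})
    (aQ : {additive KQ -> PQ}) (bQ : {additive PQ -> HQ}) (aM : {additive KM -> PM})
    (uK : {additive KL -> KQ}) (vK : {additive KQ -> KM})
    (uP : {additive PL -> PQ}) (vP : {additive PQ -> PM}) (uH : {additive HL -> HQ}) :
  (forall x, vP (aQ x) = aM (vK x)) -> (forall x, aQ (uK x) = uP (aL x)) ->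
  (forall x, bQ (uP x) = uH (bL x)) ->
  (forall x, bQ (aQ x) = 0) -> (forall x, vK (uK x) = 0) ->
  (forall y, exists x, vK x = y) ->
  (forall x, vP x = 0 -> exists y, x = uP y) ->
  (forall x, bL x = 0 -> exists y, x = aL y) ->
  injective aQ -> injective uH -> injective aM.
Proof.
move=> va au bu ba0 vu0 vK_surj vP_ex bL_ex aQ_inj uH_inj.
apply: raddf_inj => x; have [y <-] := vK_surj x.
rewrite -va => /vP_ex[z yz].
have /uH_inj/bL_ex[w zw] : uH (bL z) = uH 0 by rewrite -bu -yz ba0 raddf0.
suff -> : y = uK w by rewrite vu0.
by apply: aQ_inj; rewrite yz zw au.
Qed.

Section Tor.
Variable R : pzRingType.

Lemma tens_mapC (H1 H2 : lmodType R^c) (M1 M2 : lmodType R)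
    (f : {linear H1 -> H2}) (g : {linear M1 -> M2}) x :
  ltens H2 g (rtens f M1 x) = rtens f M2 (ltens H1 g x).
Proof. by rewrite !tens_map_comp; apply: eq_tens_map. Qed.

Lemma rtens_comp0 (A B C : lmodType R^c) (M : lmodType R)
    (f : {linear A -> B}) (g : {linear B -> C}) :
  (forall a, g (f a) = 0) -> forall x, rtens g M (rtens f M x) = 0.
Proof.
move=> gf0; apply: tens_ind => [x y xE yE|h m].
  by rewrite !tens_mapB xE yE subrr.
by rewrite !tens_map_pure gf0 tens_pure0l.
Qed.

Lemma ltens_comp0 (H : lmodType R^c) (A B C : lmodType R)
    (f : {linear A -> B}) (g : {linear B -> C}) :
  (forall a, g (f a) = 0) -> forall x, ltens H g (ltens H f x) = 0.
Proof.
move=> gf0; apply: tens_ind => [x y xE yE|h m].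
  by rewrite !tens_mapB xE yE subrr.
by rewrite !tens_map_pure gf0 tens_pure0r.
Qed.

Lemma rtens_surj (A B : lmodType R^c) (M : lmodType R) (f : {linear A -> B}) :
  (forall b, exists a, f a = b) -> forall y, exists x, rtens f M x = y.
Proof. by move=> f_surj; apply: tens_map_surj => // m; exists m. Qed.

Lemma ltens_surj (H : lmodType R^c) (A B : lmodType R) (f : {linear A -> B}) :
  (forall b, exists a, f a = b) -> forall y, exists x, ltens H f x = y.
Proof. by move=> f_surj; apply: tens_map_surj => // m; exists m. Qed.

(* As B need not be flat, this is quantified over all short exact sequences; by
   tor1_eq0_ofr it suffices to check a single one in which B is flat. *)
Definition tor1_eq0 (H : lmodType R^c) (M : lmodType R) : Prop :=
  forall (A B : lmodType R^c) (i : {linear A -> B}) (p : {linear B -> H}),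
    short_exact i p -> injective (rtens i M).

(** Chase in the 3 x 3 grid, where flatness of [Q] makes A (x) Q -> B (x) Q injective. One
    presentation of [M] thus controls all presentations of [H]. *)
Lemma tor1_eq0_ofl (H : lmodType R^c) (L Q M : lmodType R)
    (u : {linear L -> Q}) (v : {linear Q -> M}) :
  short_exact u v -> flatl Q -> injective (ltens H u) -> tor1_eq0 H M.
Proof.
move=> uv Qflat uH_inj A B i p ip.
refine (@grid_chase _ _ _ _ _ _ _ _ (rtens i L) (rtens p L) (rtens i Q) (rtens p Q)
  (rtens i M) (ltens A u) (ltens A v) (ltens B u) (ltens B v) (ltens H u)
  _ _ _ _ _ _ _ _ _ _) => /=.
- by move=> x; rewrite tens_mapC.
- by move=> x; rewrite tens_mapC.
- by move=> x; rewrite tens_mapC.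
- exact/rtens_comp0/(ses_comp0 ip).
- exact/ltens_comp0/(ses_comp0 uv).
- exact/ltens_surj/(ses_surj uv).
- exact: ltens_exact (ses_surj uv) (ses_exact uv).
- exact: rtens_exact (ses_surj ip) (ses_exact ip).
- exact/Qflat/(ses_inj ip).
- exact: uH_inj.
Qed.

(** The transposed chase, with flatness of [B] giving injectivity of B (x) L -> B (x) Q. Together
    with [tor1_eq0_ofl] this is the balance of Tor_1. *)
Lemma ltens_inj_ofr (A B H : lmodType R^c) (i : {linear A -> B}) (p : {linear B -> H})
    (L Q M : lmodType R) (u : {linear L -> Q}) (v : {linear Q -> M}) :
  short_exact i p -> flatr B -> injective (rtens i M) -> short_exact u v ->
  injective (ltens H u).
Proof.
move=> ip Bflat iM_inj uv.
refine (@grid_chase _ _ _ _ _ _ _ _ (ltens A u) (ltens A v) (ltens B u) (ltens B v)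
  (ltens H u) (rtens i L) (rtens p L) (rtens i Q) (rtens p Q) (rtens i M)
  _ _ _ _ _ _ _ _ _ _) => /=.
- by move=> x; rewrite tens_mapC.
- by move=> x; rewrite tens_mapC.
- by move=> x; rewrite tens_mapC.
- exact/ltens_comp0/(ses_comp0 uv).
- exact/rtens_comp0/(ses_comp0 ip).
- exact/rtens_surj/(ses_surj ip).
- exact: rtens_exact (ses_surj ip) (ses_exact ip).
- exact: ltens_exact (ses_surj uv) (ses_exact uv).
- exact/Bflat/(ses_inj uv).
- exact: iM_inj.
Qed.

Lemma free_flatl (T : choiceType) : flatl (freemod R T).
Proof. exact/projective_flatl/freemod_projective. Qed.

Lemma free_flatr (T : choiceType) : flatr (freemod R^c T).
Proof. exact/projective_flatr/freemod_projective. Qed.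

Lemma tor1_eq0_ltens (H : lmodType R^c) (L Q M : lmodType R)
    (u : {linear L -> Q}) (v : {linear Q -> M}) :
  tor1_eq0 H M -> short_exact u v -> injective (ltens H u).
Proof.
move=> HM uv; have sH := syzygy1_ses H.
exact: ltens_inj_ofr sH (@free_flatr _) (HM _ _ _ _ sH) uv.
Qed.

Lemma tor1_eq0_ofr (A B H : lmodType R^c) (i : {linear A -> B}) (p : {linear B -> H})
    (M : lmodType R) :
  short_exact i p -> flatr B -> injective (rtens i M) -> tor1_eq0 H M.
Proof.
move=> ip Bflat iM_inj; have sM := syzygy1_ses M.
exact: tor1_eq0_ofl sM (@free_flatl _) (ltens_inj_ofr ip Bflat iM_inj sM).
Qed.

(* Both sides say that Tor_2(H, M) = 0. *)
Lemma tor1_eq0_shift (A B H : lmodType R^c) (i : {linear A -> B}) (p : {linear B -> H})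
    (L Q M : lmodType R) (u : {linear L -> Q}) (v : {linear Q -> M}) :
  short_exact i p -> flatr B -> short_exact u v -> flatl Q ->
  tor1_eq0 A M <-> tor1_eq0 H L.
Proof.
move=> ip Bflat uv Qflat; split=> [AM|HL].
  (* In the commutative square from A (x) L to B (x) Q, both maps of the path through A (x) Q are
     injective, hence so is the first map of the other path. The converse reads the square the other
     way. *)
  apply: (tor1_eq0_ofr ip Bflat); apply: (@inj_compr _ _ _ (ltens B u)).
  apply: (@eq_inj _ _ (rtens i Q \o ltens A u)); last by move=> x; rewrite /= tens_mapC.
  exact: inj_comp (Qflat _ _ _ (ses_inj ip)) (tor1_eq0_ltens AM uv).
apply: (tor1_eq0_ofl uv Qflat); apply: (@inj_compr _ _ _ (rtens i Q)).
apply: (@eq_inj _ _ (ltens B u \o rtens i L)); last by move=> x; rewrite /= tens_mapC.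
exact: inj_comp (Bflat _ _ _ (ses_inj uv)) (HL _ _ _ _ ip).
Qed.

(** Every injection extends to a short exact sequence by its cokernel, which plays the role of
    [H]. *)
Lemma flatlP (M : lmodType R) : flatl M <-> forall H, tor1_eq0 H M.
Proof.
split=> [Mflat H A B i p ip|HM N N' f f_inj]; first exact/Mflat/(ses_inj ip).
exact: HM (cokermod_ses f_inj).
Qed.

Lemma flatrP (H : lmodType R^c) : flatr H <-> forall M, tor1_eq0 H M.
Proof.
split=> [Hflat M|HM N N' f f_inj].
  have sM := syzygy1_ses M.
  exact: tor1_eq0_ofl sM (@free_flatl _) (Hflat _ _ _ (ses_inj sM)).
exact: tor1_eq0_ltens (HM _) (cokermod_ses f_inj).
Qed.

(** With K the kernel of the augmentation, P_1 (x) M -> P_0 (x) M factors through K (x) M, and the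
    boundaries are the kernel of P_1 (x) M -> K (x) M. So homology vanishes exactly when K (x) M ->
    P_0 (x) M is injective. The free resolution gives one direction, an arbitrary one the other. *)
Lemma TorS_eq0P (H : lmodType R^c) (M : lmodType R) : TorS_eq0 0 H M <-> tor1_eq0 H M.
Proof.
split=> [HM | HM P Pproj x /= x0].
  apply: (tor1_eq0_ofr (syzygy1_ses H) (@free_flatr _)); apply: raddf_inj => z /= z0.
  have [x zx] := rtens_surj (@free_cover_surj _ (syzygy1 H)) z.
  have := HM (free_resolution H) (fun=> @freemod_projective _ _) x.
  case=> [|y xy].
    rewrite -[RHS]z0 -zx tens_map_comp.
    exact: eq_tens_map.
  rewrite -zx xy tens_map_comp.
  (* A boundary dies in the first syzygy: the second syzygy is the kernel of the free cover of the
     first. *)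
  rewrite (@eq_tens_map _ _ _ _ _ _ (\0 : {linear _ -> _}) _ idfun) //.
    elim/tens_ind: y {xy} => [y y' yE yE'|h m]; first by rewrite tens_mapB yE yE' subrr.
    by rewrite tens_map_pure tens_pure0l.
  by move=> y' /=; apply: kermod_incl0.
have aug0 y : raug P (rdiff P 0 y) = 0 by apply/raug_exact; exists y.
have sP := kermod_ses (raug_surj P).
pose q := kermod_corestr aug0 : {linear _ -> _}.
apply: (@rtens_exact _ _ _ _ _ (rdiff P 1) q).
- move=> c; have /raug_exact[b cb] := kermod_incl0 c.
  by exists b; apply: val_inj; rewrite /= -cb.
- move=> b qb; apply/rdiff_exact; have := congr1 val qb; exact.
- apply: (HM _ _ _ _ sP); rewrite tens_map0 -[RHS]x0 tens_map_comp.
  exact: eq_tens_map.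
Qed.

End Tor.

(** * Flat dimension *)

Section ResolutionDimension.
Variables (S : pzRingType) (C : lmodType S -> Prop).

(** Recursive form of [res_dim_le], peeling off one short exact sequence at a time to suit dimension
    shifting. *)
Fixpoint dim_le (n : nat) (M : lmodType S) : Prop :=
  if n is n'.+1 then
    exists K F : lmodType S, exists (i : {linear K -> F}) (p : {linear F -> M}),
      [/\ short_exact i p, C F & dim_le n' K]
  else C M.

Hypothesis C0 : forall Z : lmodType S, (forall z : Z, z = 0) -> C Z.
(** Invariance under isomorphism, phrased as a short exact sequence with zero kernel so that the
    Tor_1 criteria apply directly. *)
Hypothesis C_iso : forall (Z A B : lmodType S) (i : {linear Z -> A}) (p : {linear A -> B}),
  short_exact i p -> (forall z : Z, z = 0) -> C A -> C B.

(** Deleting the degree 0 term leaves a resolution of the kernel of the augmentation, one step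
    shorter. For n = 0 the augmentation is an isomorphism. *)
Lemma res_dim_le_dim_le n M : res_dim_le C M n -> dim_le n M.
Proof.
elim: n M => [|n IHn] M [P [CP P0]].
  have sP := kermod_ses (raug_surj P).
  apply: C_iso sP _ (CP 0%N) => z; apply: val_inj.
  by have /raug_exact[y zy] := kermod_incl0 z; rewrite [LHS]zy (P0 1%N _ y) // raddf0.
have sP := kermod_ses (raug_surj P).
exists (kermod (raug P)), (rterm P 0), (kermod_incl (raug P)), (raug P); split=> //.
apply: IHn.
have aug0 y : raug P (rdiff P 0 y) = 0 by apply/raug_exact; exists y.
pose q := kermod_corestr aug0 : {linear _ -> _}.
have q_surj (m : kermod (raug P)) : exists x, q x = m.
  have /raug_exact[y my] := kermod_incl0 m.
  by exists y; apply: val_inj; rewrite /= -my.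
have q_exact x : q x = 0 <-> exists y, x = rdiff P 1 y.
  rewrite -rdiff_exact; split=> [qx|x0]; first exact: (congr1 val qx).
  exact: val_inj.
exists (@Resolution S (kermod (raug P)) (fun i => rterm P i.+1) (fun i => rdiff P i.+1) q
  q_surj q_exact (fun i => @rdiff_exact _ _ P i.+1)).
by split=> [i|i ni]; [exact: CP | exact: (P0 i.+1)].
Qed.

Lemma dim_le_res_dim_le n M : dim_le n M -> res_dim_le C M n.
Proof.
elim: n M => [|n IHn] M /=.
  (* The kernel of an identity map serves as the zero module in positive degrees. *)
  move=> CM; pose Z : lmodType S := kermod (idfun : {linear S^o -> S^o}).
  have Z0 (z : Z) : z = 0 by case: z => z z0; apply: val_inj; apply/eqP.
  pose F i : lmodType S := if i is _.+1 then Z else M.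
  pose d i : {linear F i.+1 -> F i} := \0.
  have a_surj (m : M) : exists x : F 0%N, (idfun : {linear F 0%N -> M}) x = m by exists m.
  have a_exact (x : F 0%N) : (idfun : {linear F 0%N -> M}) x = 0 <-> exists y, x = d 0%N y.
    by split=> [x0|[y ->]] //; exists 0; exact: x0.
  have d_exact i (x : F i.+1) : d i x = 0 <-> exists y, x = d i.+1 y.
    by split=> // _; exists 0; rewrite [x]Z0.
  exists (Resolution a_surj a_exact d_exact); split=> [[|i]|[|i]] //=; exact: C0.
move=> [K [F [i [p [ip CF /IHn[G [CG G0]]]]]]].
pose T j : lmodType S := if j is j'.+1 then rterm G j' else F.
pose d j : {linear T j.+1 -> T j} :=
  (* The resolution of [K] is spliced onto [F] through G_0 -> K -> F. *)
  match j with 0 => i \o raug G | j'.+1 => rdiff G j' end.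
have a_exact (x : T 0%N) : p x = 0 <-> exists y, x = d 0%N y.
  split=> [/(ses_exact ip)[k ->]|[y ->]]; last exact: (ses_comp0 ip).
  by have [y <-] := raug_surj G k; exists y.
have d_exact j (x : T j.+1) : d j x = 0 <-> exists y, x = d j.+1 y.
  case: j x => [|j] x /=; last exact: rdiff_exact.
  rewrite -raug_exact; split=> [|->]; last exact: raddf0.
  by rewrite -(raddf0 i) => /(ses_inj ip).
exists (Resolution (rterm := T) (ses_surj ip) a_exact d_exact).
by split=> [[|j]|[|j]] //=; apply: G0.
Qed.

Lemma res_dim_leS n M : res_dim_le C M n -> res_dim_le C M n.+1.
Proof. by case=> P [CP P0]; exists P; split=> // i /ltnW; apply: P0. Qed.

Lemma res_dim_le_mono m n M : (m <= n)%N -> res_dim_le C M m -> res_dim_le C M n.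
Proof.
move=> /subnK <-; elim: (n - m)%N => // k IHk /IHk; rewrite addSn; exact: res_dim_leS.
Qed.

Definition natinf (x : \bar int) : Prop := x = +oo%E \/ exists n : nat, x = n%:Z%:E.

Lemma res_dimP M :
  (exists n, res_dim C M = n%:Z%:E /\ forall m, res_dim_le C M m <-> (n <= m)%N) \/
  (res_dim C M = +oo%E /\ forall n, ~ res_dim_le C M n).
Proof.
have [[n0 Mn0]|Mn] := pselect (exists n, res_dim_le C M n); last first.
  right; split=> [|n Mn']; last by apply: Mn; exists n.
  (* Over the empty set the infimum is its default value, chosen as [+oo]. *)
  rewrite /res_dim /infimum ifT //; apply/eqP.
  by apply/seteqP; split=> // d [n Mn' _]; apply: Mn; exists n.
left; have exP : exists n, `[< res_dim_le C M n >] by exists n0; apply/asboolP.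
case: (ex_minnP exP) => n /asboolP Mn n_min; exists n; split; last first.
  by move=> m; split=> [Mm|nm]; [apply/n_min/asboolP | apply: res_dim_le_mono nm Mn].
rewrite /res_dim /infimum ifF; last first.
  by apply/negbTE/eqP => /seteqP[] /(_ n%:Z%:E)[]; exists n.
case: xgetP => [x _ [x_lb x_glb]|/(_ n%:Z%:E)]; last first.
  case; split=> [_ [m /= Mm <-]|y]; last by apply; exists n.
  by rewrite lee_fin lez_nat; apply/n_min/asboolP.
apply/le_anti/andP; split; first by apply: x_lb; exists n.
apply: x_glb => _ [m /= Mm <-].
by rewrite lee_fin lez_nat; apply/n_min/asboolP.
Qed.

Lemma natinf_res_dim M : natinf (res_dim C M).
Proof. by case: (res_dimP M) => [[n [-> _]]|[-> _]]; [right; exists n|left]. Qed.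

Lemma res_dim_leP M n : (res_dim C M <= n%:Z%:E)%E <-> dim_le n M.
Proof.
transitivity (res_dim_le C M n); last first.
  by split; [apply: res_dim_le_dim_le|apply: dim_le_res_dim_le].
case: (res_dimP M) => [[m [-> mP]]|[-> noM]]; last by split=> // /noM.
by rewrite mP lee_fin lez_nat.
Qed.

End ResolutionDimension.

(* supremum takes an arbitrary value when no supremum exists, and \bar int is not
   a complete lattice, so existence has to be established. *)
Lemma supremum_natinf (x0 : \bar int) (A : set (\bar int)) :
  A !=set0 -> (forall a, A a -> natinf a) ->
  supremums A (supremum x0 A) /\ natinf (supremum x0 A).
Proof.
move=> [a0 Aa0] Anat.
(* An upper bound dominates some a0 >= 0, so it is itself a natural number or [+oo]. A least upper
   bound is then the smallest natural one, or [+oo] if there is none. *)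
have ubP u : ubound A u -> natinf u.
  have a0_ge0 : (0 <= a0)%E by case: (Anat _ Aa0) => [->|[n ->]] //; rewrite leey.
  move=> /(_ _ Aa0) a0u; have := le_trans a0_ge0 a0u.
  case: u {a0u} => [[n|n]||] //; rewrite ?lee_fin // => _; last by left.
  by right; exists n.
suff [s ss] : supremums A !=set0.
  rewrite /supremum ifF; last by apply/negbTE/set0P; exists a0.
  by case: xgetP => [x _ xs|/(_ s)//]; split=> //; apply/ubP; case: xs.
have [[n0 An0]|noub] := pselect (exists n : nat, ubound A n%:Z%:E); last first.
  exists +oo%E; split=> [a _|u Au]; first exact: leey.
  by move: (Au); case: (ubP u Au) => [->|[n ->]] // An; case: noub; exists n.
have exP : exists n : nat, `[< ubound A n%:Z%:E >] by exists n0; apply/asboolP.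
case: (ex_minnP exP) => n /asboolP An n_min; exists n%:Z%:E; split=> // u Au.
move: (Au); case: (ubP u Au) => [->|[m ->]] Am; first exact: leey.
by rewrite lee_fin lez_nat; apply/n_min/asboolP.
Qed.

(** * Flat dimension through syzygies, and F_1-flat modules *)

Section FlatDimensionTheory.
Variable R : pzRingType.

Lemma flatl_triv (Z : lmodType R) : (forall z : Z, z = 0) -> flatl Z.
Proof.
move=> Z0 N N' f _; apply: raddf_inj => x _.
by elim/tens_ind: x => [x y -> ->|h m]; rewrite ?subrr // [m]Z0 tens_pure0r.
Qed.

Lemma flatr_triv (Z : lmodType R^c) : (forall z : Z, z = 0) -> flatr Z.
Proof.
move=> Z0 N N' f _; apply: raddf_inj => x _.
by elim/tens_ind: x => [x y -> ->|h m]; rewrite ?subrr // [h]Z0 tens_pure0l.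
Qed.

Lemma flatl_iso (Z A B : lmodType R) (i : {linear Z -> A}) (p : {linear A -> B}) :
  short_exact i p -> (forall z : Z, z = 0) -> flatl A -> flatl B.
Proof.
move=> ip Z0 Aflat; apply/flatlP => H; apply: (tor1_eq0_ofl ip Aflat).
apply: raddf_inj => x _.
by elim/tens_ind: x => [x y -> ->|h m]; rewrite ?subrr // [m]Z0 tens_pure0r.
Qed.

Lemma flatr_iso (Z A B : lmodType R^c) (i : {linear Z -> A}) (p : {linear A -> B}) :
  short_exact i p -> (forall z : Z, z = 0) -> flatr A -> flatr B.
Proof.
move=> ip Z0 Aflat; apply/flatrP => M; apply: (tor1_eq0_ofr ip Aflat).
apply: raddf_inj => x _.
by elim/tens_ind: x => [x y -> ->|h m]; rewrite ?subrr // [h]Z0 tens_pure0l.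
Qed.

Lemma fdl_leP (M : lmodType R) n : (fdl M <= n%:Z%:E)%E <-> dim_le (@flatl R) n M.
Proof. exact: res_dim_leP flatl_triv flatl_iso M n. Qed.

Lemma fdr_leP (H : lmodType R^c) n : (fdr H <= n%:Z%:E)%E <-> dim_le (@flatr R) n H.
Proof. exact: res_dim_leP flatr_triv flatr_iso H n. Qed.

(** Induction on n: a syzygy taken on the side of [H] is traded by [tor1_eq0_shift] for a kernel on
    the side of [M]. The criterion holds for any flat cover, so the free one realizes the bound. *)
Lemma fdl_le_tor1 (M : lmodType R) n :
  (fdl M <= n%:Z%:E)%E <-> forall H : lmodType R^c, tor1_eq0 (syzygy n H) M.
Proof.
rewrite fdl_leP; elim: n M => [|n IHn] M /=; first exact: flatlP.
split=> [[K [F [u [v [uv Fflat /IHn Ktor]]]]] H | Mtor].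
  exact/(tor1_eq0_shift (syzygy1_ses _) (@free_flatr _ _) uv Fflat).
have sM := syzygy1_ses M.
exists (syzygy1 M), (freemod R M), (kermod_incl (free_cover M)), (free_cover M).
split=> //; first exact: free_flatl.
apply/IHn => H.
apply/(tor1_eq0_shift (syzygy1_ses (syzygy n H)) (@free_flatr _ _) sM (@free_flatl _ _)).
exact: Mtor.
Qed.

Lemma F1F_tor1 (M : lmodType R) : F1F M <-> forall H, F1 H -> tor1_eq0 H M.
Proof. by split=> HM H HF; apply/TorS_eq0P/HM. Qed.

(** For [H] in [F1] there is a sequence 0 -> K -> F -> H -> 0 with K and F flat; shifting turns
    Tor_1(K, M) = 0 into Tor_1(H, Syz M) = 0. *)
Lemma F1F_syzygy1 (M : lmodType R) : F1F (syzygy1 M).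
Proof.
apply/F1F_tor1 => H /(fdr_leP H 1)[K [F [i [p [ip Fflat /flatrP Ktor]]]]].
exact/(tor1_eq0_shift ip Fflat (syzygy1_ses M) (@free_flatl _ _)).
Qed.

Lemma fdl_le_syzygy1 (M : lmodType R) n :
  (fdl (syzygy1 M) <= n%:Z%:E)%E -> (fdl M <= n.+1%:Z%:E)%E.
Proof.
rewrite !fdl_leP => Kn; have sM := syzygy1_ses M.
exists (syzygy1 M), (freemod R M), (kermod_incl (free_cover M)), (free_cover M).
by split=> //; apply: free_flatl.
Qed.

Lemma F1F_fdl_lt n : (forall M : lmodType R, (fdl M <= n.+1%:Z%:E)%E) ->
  forall M : lmodType R, F1F M -> (fdl M <= n%:Z%:E)%E.
Proof.
move=> Rn M /F1F_tor1 M1; apply/fdl_le_tor1 => H; apply/M1/(fdr_leP _ 1).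
have sH := syzygy1_ses (syzygy n H).
exists (syzygy n.+1 H), (freemod R^c (syzygy n H)).
exists (kermod_incl (free_cover (syzygy n H))), (free_cover _).
split=> //; first exact: free_flatr.
(* The bound for all left modules X, read with [H] fixed, is exactly flatness of the right module
   Syz^(n+1) H. *)
by apply/flatrP => X; have /fdl_le_tor1 := Rn X; apply.
Qed.

(** Flatness of R/Ra is applied to the inclusion of aR in R. The tensor of a with the class of 1
    goes to 0, hence is 0 in aR (x) R/Ra; lifting this to aR (x) R and multiplying out puts a in
    aRa. *)
Lemma flatl_von_neumann : (forall M : lmodType R, flatl M) -> von_neumann_regular R.
Proof.
move=> Rflat a.
pose ra (r : R^o) : R^o := (r : R) * a.
have ra_lin : linear ra.
  move=> k x y; transitivity (((k : R) * (x : R) + (y : R)) * a); first by [].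
  by rewrite mulrDl -mulrA.
pose g : {linear R^o -> R^o} := HB.pack ra (GRing.isLinear.Build _ _ _ _ ra ra_lin).
pose la (r : R^c^o) : R^c^o := (a : R) * (r : R).
have la_lin : linear la.
  move=> k x y; transitivity ((a : R) * ((x : R) * (k : R) + (y : R))); first by [].
  by rewrite mulrDr mulrA.
pose f : {linear R^c^o -> R^c^o} := HB.pack la (GRing.isLinear.Build _ _ _ _ la la_lin).
(* The right ideal aR, the image of [f], is taken as the kernel of its cokernel map. *)
pose aR : lmodType R^c := kermod (cokermod_pi f : {linear _ -> _}).
pose incl : {linear aR -> R^c^o} := kermod_incl _.
pose M : lmodType R := cokermod g.
pose pr : {linear R^o -> M} := cokermod_pi g.
have inclP (n : aR) : exists c : R, incl n = a * c :> R.
  by have /cokermod_pi0[c nc] := kermod_incl0 n; exists c.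
have [n0 n0a] : exists n : aR, incl n = a.
  apply/kermod_lift/cokermod_pi0; exists (1 : R).
  by rewrite -[RHS]/(a * 1) mulr1.
have pr_surj m : exists r, pr r = m by exists (cokermod_repr m); apply: cokermod_reprK.
have pr_ker r : pr r = 0 -> exists c, r = g c by move/cokermod_pi0.
have pure0 : tens_pure n0 (pr (1 : R)) = 0.
  apply: (Rflat M _ _ incl); first exact: kermod_incl_inj.
  rewrite tens_map0 tens_map_pure n0a.
  have -> : a = (a : R^c) *: (1 : R^c^o) by rewrite -[RHS]/(1 * a) mul1r.
  rewrite tens_pureZ; have -> : a *: pr (1 : R) = 0; last exact: tens_pure0r.
  rewrite -linearZ; apply/cokermod_pi0; exists (1 : R).
  by rewrite -[RHS]/(1 * a) mul1r -[LHS]/(a * 1) mulr1.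
(* By right exactness a (x) 1 comes from aR (x) R through right multiplication by a on the second
   factor. *)
have [|z zE] := ltens_exact pr_surj pr_ker (x := tens_pure n0 (1 : R^o)).
  by rewrite tens_map_pure pure0.
pose b (n : aR) (r : R^o) : R := (incl n : R) * (r : R).
have bDl n n' r : b (n + n') r = b n r + b n' r by rewrite /b linearD; apply: mulrDl.
have bDr n r r' : b n (r + r') = b n r + b n r' by apply: mulrDr.
have bZ n (k : R) r : b ((k : R^c) *: n) r = b n (k *: r).
  by rewrite /b linearZ; symmetry; apply: mulrA.
have muB := tens_lift_zmod_morphism bDl bDr bZ.
have mu_pure := tens_lift_pure bDl bDr bZ.
(* Under multiplication the image of ac (x) r is a(cr)a, and such elements are closed under
   differences. *)
have [t tE] : exists t, tens_lift b (ltens aR g z) = a * t * a.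
  elim/tens_ind: z {zE} => [x y [t xE] [t' yE]|n r].
    by exists (t - t'); rewrite tens_mapB muB xE yE mulrBr mulrBl.
  have [c nc] := inclP n; exists (c * r).
  rewrite tens_map_pure mu_pure /b nc -[LHS]/(a * c * ((r : R) * a)).
  by rewrite !mulrA.
by exists t; rewrite -tE -zE mu_pure /b n0a mulr1.
Qed.

End FlatDimensionTheory.

(** * Weak global dimension against flat dimensions of F_1-flat modules *)

Theorem proposition4p10 (R : pzRingType) :
  von_neumann_regular R \/
  wgldim R =
    (1%:E + supremum -oo [set d | exists2 M : lmodType R, F1F M & d = fdl M])%E.
Proof.
have [|Rreg] := pselect (von_neumann_regular R); [by left | right].
(* This witness makes the second set nonempty, so its supremum is a true least upper bound and not
   the default [-oo]. *)
have flat0 : F1F (syzygy1 (R^o : lmodType R)) by exact: F1F_syzygy1.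
have [||[w_ub w_lub] w_nat] :=
    @supremum_natinf -oo%E [set d | exists M : lmodType R, d = fdl M].
- by exists (fdl (R^o : lmodType R)), R^o.
- by move=> _ [M ->]; apply: natinf_res_dim.
have [||[s_ub s_lub] s_nat] :=
    @supremum_natinf -oo%E [set d | exists2 M : lmodType R, F1F M & d = fdl M].
- by exists (fdl (syzygy1 (R^o : lmodType R))); exists (syzygy1 (R^o : lmodType R)).
- by move=> _ [M _ ->]; apply: natinf_res_dim.
move: w_ub w_lub w_nat s_ub s_lub s_nat; rewrite -/(wgldim R).
set w := wgldim R; set s := supremum _ _ => w_ub w_lub w_nat s_ub s_lub s_nat.
apply/le_anti/andP; split.
  apply: w_lub => _ [M ->]; case: s_nat => [s_oo|[n sn]]; first by rewrite s_oo leey.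
  rewrite sn -EFinD -intS; apply/fdl_le_syzygy1; rewrite -sn; apply: s_ub.
  by exists (syzygy1 M) => //; apply: F1F_syzygy1.
case: w_nat => [->|[n wn]]; first exact: leey.
have w_le (M : lmodType R) : (fdl M <= n%:Z%:E)%E by rewrite -wn; apply: w_ub; exists M.
(* Weak dimension 0 would make every left module flat, against the assumption on [R]; hence it is a
   successor and 1 can be subtracted. *)
case: n wn w_le => [|n] wn w_le.
  by case: Rreg; apply: flatl_von_neumann => M; apply/(fdl_leP M 0).
have : (s <= n%:Z%:E)%E by apply: s_lub => _ [M M1 ->]; apply: F1F_fdl_lt.
by rewrite wn; case: s_nat => [->|[m ->]].
Qed.
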